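(* Let $\mathcal{F}$ and $\mathcal{G}$ be proper nontrivial subspaces of a real or complex Hilbert space $\mathcal{H}$, and let $$c(\mathcal{F},\mathcal{G})=\sup\{|(f,g)|:\ f\in\mathcal{F}\ominus(\mathcal{F}\cap\mathcal{G}),\ \|f\|\le 1,\ g\in\mathcal{G}\ominus(\mathcal{F}\cap\mathcal{G}),\ \|g\|\le 1\}$$ be the cosine of the angle of Friedrichs. Then $$c(\mathcal{F},\mathcal{G})=\cos\left(\inf\{\Theta(\mathcal{F},\mathcal{G})\setminus\{0\}\}\right).$$
   Context: A subspace means a closed linear manifold; nontrivial means different from $\{0\}$, proper means different from $\mathcal{H}$. $\mathcal{F}\ominus\mathcal{G}=\mathcal{F}\cap\mathcal{G}^\perp$. $P_{\mathcal{F}}$ denotes the orthogonal projector onto $\mathcal{F}$; $\Sigma$ denotes the spectrum; $(P_{\mathcal{F}}P_{\mathcal{G}})|_{\mathcal{F}}$ is regarded as an operator $\mathcal{F}\to\mathcal{F}$. The set of angles from $\mathcal{F}$ to $\mathcal{G}$ is $$\hat{\Theta}(\mathcal{F},\mathcal{G})=\{\theta:\theta=\arccos(\sigma),\ \sigma\ge 0,\ \sigma^2\in\Sigma((P_{\mathcal{F}}P_{\mathcal{G}})|_{\mathcal{F}})\}\subseteq[0,\pi/2],$$ and the set of angles between $\mathcal{F}$ and $\mathcal{G}$ is $\Theta(\mathcal{F},\mathcal{G})=\hat{\Theta}(\mathcal{F},\mathcal{G})\cap\hat{\Theta}(\mathcal{G},\mathcal{F})$. The infimum is taken in $[0,\pi/2]$,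 so that $\inf\emptyset=\pi/2$. *)

(* Defs.v *)
From HB Require Import structures.
From mathcomp Require Import all_boot all_order all_algebra.
From mathcomp Require Import all_classical all_reals all_analysis.
From mathcomp Require Import complex.

Set Implicit Arguments.
Unset Strict Implicit.
Unset Printing Implicit Defensive.

Import Order.TTheory GRing.Theory Num.Theory.
Import numFieldNormedType.Exports.

Local Open Scope classical_set_scope.
Local Open Scope ring_scope.

(** A Hilbert space over [scalars R k] is a [completeNormedModType] together
    with a positive definite hermitian form [dot] (linear in its first
    argument) such that [dot x x = `|x| ^+ 2].  In the complex case norms are
    elements of [R[i]] with zero imaginary part; [of_real] is used to compare
    them with elements of [R]. *)

Variant scalar_kind := RealScalars | ComplexScalars.

Definition scalars (R : realType) (k : scalar_kind) : numFieldType :=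
  match k with
  | RealScalars => R
  | ComplexScalars => R[i]
  end.

Definition conj_scalar (R : realType) (k : scalar_kind) :
    scalars R k -> scalars R k :=
  match k with
  | RealScalars => idfun
  | ComplexScalars => @conjc R
  end.

Definition of_real (R : realType) (k : scalar_kind) : R -> scalars R k :=
  match k with
  | RealScalars => idfun
  | ComplexScalars => real_complex R
  end.

Section HilbertSubspaces.
Variables (R : realType) (k : scalar_kind).
Local Notation K := (scalars R k).
Variable H : completeNormedModType K.
Variable dot : {dot H for @conj_scalar R k}.

Implicit Types (F G : set H) (T : H -> H).

Definition is_subspace F :=
  [/\ closed F, F 0 & forall (a : K) x y, F x -> F y -> F (a *: x + y)].

Definition orthocomplement G : set H :=
  [set x | forall y, G y -> dot x y = 0].

Definition ominus F G : set H := F `&` orthocomplement G.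

(** [projector F x] is the unique [y] in [F] with [x - y] orthogonal to [F];
    it exists when [F] is a subspace, and the default value [0] is then
    irrelevant. *)
Definition projector F (x : H) : H :=
  xget 0 [set y | F y /\ orthocomplement F (x - y)].

(** [S] restricts to a bounded linear operator from [F] to [F]; its values
    outside [F] play no role. *)
Definition bounded_operator_on F (S : H -> H) :=
  [/\ forall x, F x -> F (S x),
      forall (a : K) x y, F x -> F y -> S (a *: x + y) = a *: S x + S y
    & exists M : K, forall x, F x -> `|S x| <= M * `|x| ].

(** Spectrum of the restriction of [T] to [F], regarded as an operator from
    [F] to [F]: the scalars [l] for which [T - l] has no bounded inverse
    on [F]. *)
Definition spectrum_on F T : set K :=
  [set l | ~ exists S : H -> H, bounded_operator_on F S /\
     forall x, F x -> S (T x - l *: x) = x /\ T (S x) - l *: S x = x].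

Definition angles_from F G : set R :=
  [set acos s | s in [set s : R | 0 <= s /\
     spectrum_on F (projector F \o projector G) (of_real k (s ^+ 2))]].

Definition angles F G : set R := angles_from F G `&` angles_from G F.

(** [|dot f g|] is a nonnegative real seen in [K]; [r] is its value in [R]. *)
Definition friedrichs_cos F G : R :=
  sup [set r : R | exists f g,
    [/\ ominus F (F `&` G) f, `|f| <= 1, ominus G (F `&` G) g, `|g| <= 1
      & of_real k r = `|dot f g| ] ].

End HilbertSubspaces.

(** Infimum in the ordered set [0, pi/2], for [A] included in [0, pi/2]: the
    empty set has infimum [pi/2], whereas [inf set0 = 0] in the library. *)
Definition inf_angle (R : realType) (A : set R) : R :=
  if `[< A = set0 >] then pi / 2 else inf A.

(* Main.v *)
Require Import Defs.
From HB Require Import structures.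
From mathcomp Require Import all_boot all_order all_algebra.
From mathcomp Require Import all_classical all_reals all_analysis.
From mathcomp Require Import complex ring lra.

(** Write [T] for the restriction of [P_F P_G] to [F], [M] for the
    intersection of [F] and [G], [F0] and [G0] for the orthocomplements of [M]
    in [F] and in [G], and [c] for the cosine of Friedrichs.  The operator [T]
    is symmetric with [(T f, f) = |P_G f|^2]; it is the identity on [M] and
    maps [F0] to itself, where the supremum of its quadratic form over the
    unit ball is [c^2], because [|P_G f|] is the supremum of [|(f, g)|] over
    [g] in the unit ball of [G].  Hence the spectrum of [T], apart from [1], is
    bounded by [c^2], so every nonzero angle is at least [acos c]
    ([bounded_below_off_spectrum]).

    For the converse inequality it is enough that the spectrum of [T] meets
    [(a, 1)] for every [a < c^2]; in the case [c = 1] the point [1] itself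
    would not do, as it only gives the angle [0].
    Suppose that [(a, 1)] contains no point of the spectrum.  The distance
    from a real number to the spectrum of a symmetric operator bounds that
    operator from below ([spectral_gap]); at the midpoint of [(a, 1)], and in
    terms of [U = 1 - T], the bound reads [(1 - a) (U x, x) <= |U x|^2].  This
    passes to [(1 - a) |x|^2 <= (U x, x)] on the closure of the range of [U],
    which is [F0] as the kernel of [U] is [M] ([form_bound_coker]).  So the
    form of [T] is at most [a] on [F0], that is [c^2 <= a]
    ([spectral_gap_cosine]).  Nonzero points of the spectra of [P_F P_G] on
    [F] and of [P_G P_F] on [G] are the same ([bounded_below_swap]), so the
    angles found belong to both sets of angles.

    The real part of the inner product turns a complex Hilbert space into a
    real one with the same norm, the same closed sets and the same projectors.
    All the operator theory is done there.  The spectrum is the only notion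
    that sees the scalars, and at a real point it is the failure of
    [bounded_below]: a symmetric operator that is bounded below on a closed
    manifold is onto ([symop_surj]), and its inverse is automatically linear
    over the original scalars ([spectrum_onP]). *)

Set Implicit Arguments.
Unset Strict Implicit.
Unset Printing Implicit Defensive.

Import Order.TTheory GRing.Theory Num.Theory.
Import numFieldNormedType.Exports.

Local Open Scope classical_set_scope.
Local Open Scope ring_scope.

(** * Real inner product spaces *)

Section RealHilbert.
Variables (R : realType) (V : lmodType R) (ip : V -> V -> R).

Record inner_product : Prop := InnerProduct {
  ipC : forall x y, ip x y = ip y x;
  ip_linear : forall a x y z, ip (a *: x + y) z = a * ip x z + ip y z;
  ip_ge0 : forall x, 0 <= ip x x;
  ip_eq0 : forall x, ip x x = 0 -> x = 0 }.

(** Completeness and closedness are phrased with squared norms only, so that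
    neither a topology nor a square root is needed on the real space. *)
Definition ip_complete := forall u : nat -> V,
  (forall e : R, 0 < e -> exists N, forall m n, (N <= m)%N -> (N <= n)%N ->
     ip (u m - u n) (u m - u n) < e) ->
  exists l, forall e : R, 0 < e -> exists N, forall n, (N <= n)%N ->
     ip (u n - l) (u n - l) < e.

Definition adherent (D : set V) : set V :=
  [set x | forall e : R, 0 < e -> exists2 y, D y & ip (x - y) (x - y) < e].

Record linear_manifold (D : set V) : Prop := LinearManifold {
  manifold0 : D 0;
  manifoldP : forall a x y, D x -> D y -> D (a *: x + y) }.

Record closed_manifold (D : set V) : Prop := ClosedManifold {
  closed_manifold_linear :> linear_manifold D;
  manifold_closed : adherent D `<=` D }.

(** For [A] symmetric on a closed manifold this is bounded invertibility of
    [A]; applied to [A = T - l] it says that [l] is not in the spectrum. *)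
Definition bounded_below (D : set V) (A : V -> V) :=
  exists2 m : R, 0 < m & forall x, D x -> m * ip x x <= ip (A x) (A x).

Record symmetric_operator (D : set V) (A : V -> V) : Prop := SymmetricOperator {
  symop_stable : forall x, D x -> D (A x);
  symop_linear : forall a x y, A (a *: x + y) = a *: A x + A y;
  symop_sym : forall x y, D x -> D y -> ip (A x) y = ip x (A y);
  symop_bounded : exists2 N : R, 0 < N &
     forall x, D x -> ip (A x) (A x) <= N * ip x x }.

Hypothesis ipH : inner_product.

Lemma ipDl x y z : ip (x + y) z = ip x z + ip y z.
Proof. by rewrite -[x]scale1r (ip_linear ipH) mul1r scale1r. Qed.
Lemma ip0l z : ip 0 z = 0.
Proof. by apply: (addrI (ip 0 z)); rewrite -ipDl !addr0. Qed.
Lemma ipZl a x z : ip (a *: x) z = a * ip x z.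
Proof. by rewrite -[a *: x]addr0 (ip_linear ipH) ip0l addr0. Qed.
Lemma ipNl x z : ip (- x) z = - ip x z.
Proof. by rewrite -scaleN1r ipZl mulN1r. Qed.
Lemma ipDr x y z : ip z (x + y) = ip z x + ip z y.
Proof. by rewrite (ipC ipH) ipDl !(ipC ipH z). Qed.
Lemma ip0r z : ip z 0 = 0. Proof. by rewrite (ipC ipH) ip0l. Qed.
Lemma ipZr a x z : ip z (a *: x) = a * ip z x.
Proof. by rewrite (ipC ipH) ipZl (ipC ipH z). Qed.
Lemma ipNr x z : ip z (- x) = - ip z x.
Proof. by rewrite (ipC ipH) ipNl (ipC ipH z). Qed.
Definition ipE := (ipDl, ipDr, ipNl, ipNr, ipZl, ipZr, ip0l, ip0r).

Lemma ip_young t x y : 0 < t -> 2 * ip x y <= t * ip x x + t^-1 * ip y y.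
Proof.
move=> t0; have := ip_ge0 ipH (t *: x - y).
rewrite !ipE (ipC ipH y x) => h.
have ti : 0 < t^-1 by rewrite invr_gt0.
have : 0 <= t^-1 * (t * (t * ip x x) - t * ip x y - (t * ip x y - ip y y)).
  by apply: mulr_ge0; [exact: ltW | lra].
have tt : t^-1 * t = 1 by rewrite mulVf// gt_eqF.
have -> : t^-1 * (t * (t * ip x x) - t * ip x y - (t * ip x y - ip y y)) =
  (t^-1 * t) * (t * ip x x) - (t^-1 * t) * 2 * ip x y + t^-1 * ip y y by ring.
by rewrite tt; lra.
Qed.

Lemma cauchy_schwarz x y : ip x y ^+ 2 <= ip x x * ip y y.
Proof.
have [x0|x0] := eqVneq (ip x x) 0.
  by rewrite (ip_eq0 ipH x0) !ipE expr0n mul0r.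
have xp : 0 < ip x x by rewrite lt_neqAle eq_sym x0 (ip_ge0 ipH).
have := ip_ge0 ipH (ip x y *: x - ip x x *: y).
rewrite !ipE (ipC ipH y x) => h.
suff: 0 <= ip x x * (ip x x * ip y y - ip x y ^+ 2).
  by rewrite pmulr_rge0// subr_ge0.
by apply: le_trans h _; rewrite le_eqVlt; apply/orP; left; apply/eqP; ring.
Qed.

Section Manifold.
Variable D : set V.
Hypothesis linD : linear_manifold D.

Lemma manifoldZ a x : D x -> D (a *: x).
Proof.
by move=> Dx; rewrite -[_ *: _]addr0; apply: manifoldP => //; apply: manifold0.
Qed.
Lemma manifoldD x y : D x -> D y -> D (x + y).
Proof. by move=> *; rewrite -[x]scale1r; apply: manifoldP. Qed.
Lemma manifoldB x y : D x -> D y -> D (x - y).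
Proof. by move=> *; rewrite addrC -scaleN1r; apply: manifoldP. Qed.

Lemma adherent_manifold : closed_manifold (adherent D).
Proof.
have tri (u v : V) : ip (u + v) (u + v) <= 2 * ip u u + 2 * ip v v.
  have := ip_ge0 ipH (u - v); rewrite !ipE (ipC ipH v u); lra.
split; first split.
- move=> e e0; exists 0; first exact: manifold0.
  by rewrite subrr ip0l.
- move=> a x y Dx Dy e e0.
  have k0 : 0 < 2 * a ^+ 2 + 2 by have := sqr_ge0 a; lra.
  have [d d0 ->] : exists2 d : R, 0 < d & e = d * (2 * a ^+ 2 + 2).
    by exists (e / (2 * a ^+ 2 + 2)); rewrite ?divr_gt0// mulfVK// gt_eqF.
  have [x' Dx' hx] := Dx _ d0; have [y' Dy' hy] := Dy _ d0.
  exists (a *: x' + y'); first exact: manifoldP.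
  have -> : a *: x + y - (a *: x' + y') = a *: (x - x') + (y - y').
    by rewrite scalerBr opprD addrACA.
  apply: le_lt_trans (tri _ _) _; rewrite ipZl ipZr.
  have := ler_wpM2l (sqr_ge0 a) (ltW hx); nra.
- move=> x Dx e e0.
  have e4 : 0 < e / 4 by lra.
  have [y Dy hy] := Dx _ e4; have [z Dz hz] := Dy _ e4.
  exists z => //; have -> : x - z = (x - y) + (y - z) by rewrite addrA subrK.
  apply: le_lt_trans (tri _ _) _; lra.
Qed.

Lemma subset_adherent : D `<=` adherent D.
Proof. by move=> x Dx e e0; exists x => //; rewrite subrr ip0l. Qed.

End Manifold.

Lemma linear_sub0 (A : V -> V) :
  (forall a x y, A (a *: x + y) = a *: A x + A y) ->
  [/\ A 0 = 0, forall x y, A (x - y) = A x - A y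
    & forall a x, A (a *: x) = a *: A x].
Proof.
move=> linA.
have A0 : A 0 = 0.
  by apply: (addrI (A 0)); rewrite -{1}[A 0]scale1r -linA scale1r !addr0.
split=> // [x y|a x]; first by rewrite addrC -scaleN1r linA scaleN1r addrC.
by rewrite -[_ *: x]addr0 linA A0 addr0.
Qed.

Hypothesis complete_ip : ip_complete.

Lemma cvg_adherent D (u : nat -> V) l : (forall n, D (u n)) ->
  (forall e : R, 0 < e -> exists N, forall n, (N <= n)%N ->
     ip (u n - l) (u n - l) < e) -> adherent D l.
Proof.
move=> Du ul e e0; have [N hN] := ul _ e0.
by exists (u N) => //; rewrite -opprB ipNl ipNr opprK; apply: hN.
Qed.

(** * The projection theorem *)

Lemma invS_small (e : R) : 0 < e ->
  exists N, forall n, (N <= n)%N -> n.+1%:R^-1 < e.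
Proof.
move=> e0; have [N _ hN] := near_infty_natSinv_lt (PosNum e0).
by exists N => n /hN.
Qed.

(** A sequence minimizing the distance to [x] is Cauchy by the parallelogram
    identity.  Orthogonality of the limit is obtained from the terms of the
    sequence: the nearer [u n] is to the infimum, the less can be gained by
    moving it along [z], which forces [ip (x - u n) z] to tend to [0]. *)
Lemma projection_exists D x : closed_manifold D ->
  exists2 y, D y & forall z, D z -> ip (x - y) z = 0.
Proof.
move=> cD.
pose E := [set r | exists2 y, D y & r = ip (x - y) (x - y)].
have infE : has_inf E.
  split; first by exists (ip (x - 0) (x - 0)), 0 => //; exact: (manifold0 cD).
  by exists 0 => _ [y _ ->]; exact: ip_ge0.
pose d : R := inf E.
have dle y : D y -> d <= ip (x - y) (x - y).
  by move=> Dy; apply: ge_inf; [case: infE | exists y].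
have ex n : exists y, D y /\ ip (x - y) (x - y) < d + n.+1%:R^-1.
  have n0 : 0 < n.+1%:R^-1 :> R by rewrite invr_gt0.
  by have [_ [y Dy ->] h] := inf_adherent n0 infE; exists y.
have [u hu] := choice ex.
have Du n : D (u n) by case: (hu n).
have [|y uy] := complete_ip (u := u).
  move=> e e0; have [|N hN] := invS_small (e := e / 4); first lra.
  exists N => m n /hN m4 /hN n4.
  have [_ um] := hu m; have [_ un] := hu n.
  have := dle _ (manifoldZ cD 2^-1 (manifoldD cD (Du m) (Du n))).
  move: um un m4 n4; move: m.+1%:R^-1 n.+1%:R^-1 => a b.
  rewrite !ipE !(ipC ipH (u _) x) (ipC ipH (u n) (u m)); lra.
exists y => [|z Dz].
  exact/(manifold_closed cD)/(cvg_adherent (u := u)).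
have [z0|z0] := eqVneq (ip z z) 0; first by rewrite (ip_eq0 ipH z0) ip0r.
have zp : 0 < ip z z by rewrite lt_neqAle eq_sym z0 (ip_ge0 ipH).
apply/eqP; apply: contraT => s0.
set s := ip _ _ in s0.
have s2 : 0 < s ^+ 2 by rewrite exprn_even_gt0.
have e0 : 0 < s ^+ 2 / (4 * ip z z) by rewrite divr_gt0//; lra.
have [N1 hN1] := uy _ e0; have [N2 hN2] := invS_small e0.
pose n := maxn N1 N2.
have {hN1} h1 := hN1 n (leq_maxl _ _); have {hN2} h2 := hN2 n (leq_maxr _ _).
have [_ un] := hu n.
set r := ip (x - u n) z.
(* [r / ip z z] is the best coefficient for correcting [u n] along [z] *)
have r2 : r ^+ 2 <= ip z z * n.+1%:R^-1.
  have := dle _ (manifoldD cD (Du n) (manifoldZ cD (r / ip z z) Dz)).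
  rewrite opprD addrA; move: (x - u n) @r un => w r un.
  rewrite !ipE (ipC ipH z) -/r mulfVK// => h.
  have : r * (r / ip z z) <= n.+1%:R^-1.
    rewrite [r * _]mulrC; move: h un; rewrite mulrN.
    by move: (_ / _ * r) n.+1%:R^-1 => a b; lra.
  by rewrite mulrA -expr2 ler_pdivrMr// mulrC.
have st : s = r + ip (u n - y) z by rewrite -ipDl addrA subrK.
have cs := cauchy_schwarz (u n - y) z.
have : s ^+ 2 <= 2 * r ^+ 2 + 2 * ip (u n - y) z ^+ 2.
  by rewrite st; have := sqr_ge0 (r - ip (u n - y) z); nra.
move: h1 h2; rewrite !ltr_pdivlMr ?mulr_gt0//.
by move: r2 cs; move: n.+1%:R^-1 => a; lra.
Qed.

(** * Symmetric operators on a closed manifold *)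

Lemma shift_symop D A l : linear_manifold D -> symmetric_operator D A ->
  symmetric_operator D (fun x => A x - l *: x).
Proof.
move=> lD sA; have [N N0 hN] := symop_bounded sA.
split=> [x Dx|a x y|x y Dx Dy|].
- by apply: manifoldB => //; [exact: (symop_stable sA) | exact: manifoldZ].
- rewrite (symop_linear sA) scalerBr scalerDr opprD addrACA.
  by congr (_ + (_ - _)); rewrite !scalerA mulrC.
- by rewrite !ipE (symop_sym sA).
- exists (2 * N + 2 * l ^+ 2); first by have := sqr_ge0 l; lra.
  move=> x Dx; have := hN x Dx; have := ip_ge0 ipH (A x + l *: x).
  rewrite !ipE (ipC ipH x (A x)); nra.
Qed.

Lemma comp_symop D A B : symmetric_operator D A -> symmetric_operator D B ->
  (forall x, D x -> A (B x) = B (A x)) ->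
  symmetric_operator D (A \o B).
Proof.
move=> sA sB AB; have [N N0 hN] := symop_bounded sA.
have [M M0 hM] := symop_bounded sB.
split=> [x Dx|a x y|x y Dx Dy|] /=.
- exact/(symop_stable sA)/(symop_stable sB).
- by rewrite (symop_linear sB) (symop_linear sA).
- rewrite (symop_sym sA)// ?(symop_sym sB)// ?AB//; 
  first [exact: (symop_stable sB)|exact: (symop_stable sA)].
- exists (N * M); first exact: mulr_gt0.
  move=> x Dx; apply: le_trans (hN _ (symop_stable sB Dx)) _.
  by rewrite -mulrA ler_pM2l// hM.
Qed.

(** The range is closed, since bounds from below carry Cauchy sequences back,
    and its orthogonal complement is the kernel, which is trivial. *)
Lemma symop_surj D A : closed_manifold D -> symmetric_operator D A ->
  bounded_below D A -> forall y, D y -> exists2 x, D x & A x = y.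
Proof.
move=> cD sA [m m0 hm].
have [A0 AB AZ] := linear_sub0 (symop_linear sA).
have cI : closed_manifold (A @` D).
  split; first split.
  - by exists 0 => //; exact: (manifold0 cD).
  - move=> a _ _ [x Dx <-] [y Dy <-]; exists (a *: x + y).
      exact: (manifoldP cD).
    exact: (symop_linear sA).
  - move=> y hy.
    have ex n : exists x, D x /\ ip (y - A x) (y - A x) < n.+1%:R^-1.
      by have [|_ [x Dx <-] h] := hy n.+1%:R^-1; [rewrite invr_gt0 | exists x].
    have [u hu] := choice ex.
    have Du n : D (u n) by case: (hu n).
    have [|x ux] := complete_ip (u := u).
      move=> e e0.
      have [|N hN] := invS_small (e := m * e / 4); first nra.
      exists N => i j /hN i4 /hN j4; rewrite -(ltr_pM2l m0).
      have [_ ui] := hu i; have [_ uj] := hu j.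
      apply: le_lt_trans (hm _ (manifoldB cD (Du i) (Du j))) _.
      rewrite AB; have := ip_ge0 ipH ((y - A (u i)) + (y - A (u j))).
      move: ui uj i4 j4; move: i.+1%:R^-1 j.+1%:R^-1 => a b.
      rewrite !ipE !(ipC ipH (A _) y) (ipC ipH (A (u j)) (A (u i))); lra.
    have Dx : D x.
      by apply: (manifold_closed cD); exact: (cvg_adherent (u := u)).
    exists x => //; apply/esym/subr0_eq/(ip_eq0 ipH)/eqP/contraT => q0.
    have q : 0 < ip (y - A x) (y - A x).
      by rewrite lt_neqAle eq_sym q0 (ip_ge0 ipH).
    have [N N0 hN] := symop_bounded sA.
    have [|k hk] := invS_small (e := ip (y - A x) (y - A x) / 4); first lra.
    have e0 : 0 < ip (y - A x) (y - A x) / (4 * N).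
      by rewrite divr_gt0// mulr_gt0.
    have [k' hk'] := ux _ e0.
    pose n := maxn k k'.
    have {hk} h1 := hk n (leq_maxl _ _); have {hk'} := hk' n (leq_maxr _ _).
    rewrite ltr_pdivlMr ?mulr_gt0// => h2.
    have [_ un] := hu n.
    have := hN _ (manifoldB cD (Du n) Dx); rewrite AB.
    have := ip_ge0 ipH ((y - A (u n)) - (A (u n) - A x)).
    move: h1 h2; have -> : y - A x = (y - A (u n)) + (A (u n) - A x).
      by rewrite addrA subrK.
    move: (y - A (u n)) (A (u n) - A x) un => v w.
    by rewrite !ipE (ipC ipH w v); move: n.+1%:R^-1 => a; nra.
move=> y Dy; have [_ [x Dx <-] yx] := projection_exists y cI.
have DAz : D (y - A x) by apply: (manifoldB cD) => //; exact: (symop_stable sA).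
exists x => //; apply/esym/subr0_eq/(ip_eq0 ipH).
suff Az0 : A (y - A x) = 0.
  apply/eqP; rewrite eq_le (ip_ge0 ipH) andbT -(pmulr_rle0 _ m0).
  by apply: le_trans (hm _ DAz) _; rewrite Az0 ip0l.
have DAAz := symop_stable sA DAz.
apply: (ip_eq0 ipH); rewrite (symop_sym sA)//.
by apply: yx; exists (A (y - A x)).
Qed.

(** The form of a nonnegative [A] is evaluated at [x - C^-1 A x], one step of
    gradient descent from [x]. *)
Lemma nonneg_symop_bound D A : symmetric_operator D A ->
  (forall x, D x -> 0 <= ip (A x) x) -> linear_manifold D ->
  exists2 C : R, 0 < C & forall x, D x -> ip (A x) (A x) <= C * ip (A x) x.
Proof.
move=> sA A_ge0 lD; have [N N0 hN] := symop_bounded sA.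
have [A0 AB AZ] := linear_sub0 (symop_linear sA).
pose C := (N + 1) / 2; have C0 : 0 < C by rewrite /C; lra.
exists C => // x Dx.
have DAx := symop_stable sA Dx.
have AAx : ip (A (A x)) (A x) <= C * ip (A x) (A x).
  have := ip_young (A (A x)) (A x) ltr01; have := hN _ DAx.
  rewrite invr1 /C; lra.
have := A_ge0 _ (manifoldB lD Dx (manifoldZ lD C^-1 DAx)).
rewrite AB AZ !ipE (symop_sym sA DAx Dx).
have Ci : 0 < C^-1 by rewrite invr_gt0.
have : C^-1 * (C^-1 * ip (A (A x)) (A x)) <= C^-1 * ip (A x) (A x).
  by rewrite ler_pM2l// ler_pdivrMl.
move=> h1 h2; rewrite -ler_pdivrMl//; lra.
Qed.

(** A symmetric operator is bounded from below by the distance from [0] to its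
    spectrum.  Let [s^2] be the infimum of [|A x|^2 / |x|^2].  If [s < r], then
    [A - s] and [A + s] are bounded below, hence so is [A^2 - s^2]; being
    nonnegative, this operator then has a form bounded below by a positive
    multiple of [|x|^2], against the choice of [s]. *)
Lemma spectral_gap D A r : linear_manifold D -> symmetric_operator D A ->
  0 <= r -> (forall t, `|t| < r -> bounded_below D (fun x => A x - t *: x)) ->
  forall x, D x -> r ^+ 2 * ip x x <= ip (A x) (A x).
Proof.
move=> lD sA r0 hA x0 Dx0; rewrite leNgt; apply/negP => hx0.
have [A0 AB AZ] := linear_sub0 (symop_linear sA).
have x0_gt0 : 0 < ip x0 x0.
  rewrite lt_neqAle (ip_ge0 ipH) andbT eq_sym; apply/eqP => /(ip_eq0 ipH) x00.
  by move: hx0; rewrite x00 A0 !ip0l mulr0 ltxx.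
pose E := [set s | exists2 x, D x /\ 0 < ip x x & s = ip (A x) (A x) / ip x x].
have infE : has_inf E.
  split; first by exists (ip (A x0) (A x0) / ip x0 x0), x0.
  exists 0 => _ [x [Dx xp] ->].
  by apply: divr_ge0; [exact: ip_ge0 | exact: ltW].
pose s2 : R := inf E.
have s2_ge0 : 0 <= s2.
  apply: lb_le_inf; first by case: infE.
  move=> _ [x [Dx xp] ->].
  by apply: divr_ge0; [exact: ip_ge0 | exact: ltW].
have s2_le x : D x -> s2 * ip x x <= ip (A x) (A x).
  move=> Dx; have [x_le0|xp] := leP (ip x x) 0.
    have xx0 : ip x x = 0 by apply/eqP; rewrite eq_le x_le0 (ip_ge0 ipH).
    by rewrite xx0 mulr0; exact: ip_ge0.
  by rewrite -ler_pdivlMr//; apply: ge_inf; [case: infE | exists x].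
have s2_lt : s2 < r ^+ 2.
  apply: le_lt_trans (_ : ip (A x0) (A x0) / ip x0 x0 < _).
    by apply: ge_inf; [case: infE | exists x0].
  by rewrite ltr_pdivrMr.
pose s := Num.sqrt s2.
have ss : s ^+ 2 = s2 by rewrite sqr_sqrtr.
have s_lt : s < r by rewrite -(ltr_pXn2r (n := 2)) ?nnegrE ?sqrtr_ge0// ss.
have s_norm : `|s| = s by rewrite ger0_norm// sqrtr_ge0.
have [m m0 hm] := hA s ltac:(by rewrite s_norm).
have [m' m'0 hm'] := hA (- s) ltac:(by rewrite normrN s_norm).
pose P x := A (A x) - s2 *: x.
have sAA : symmetric_operator D (A \o A) by exact: comp_symop.
have sP : symmetric_operator D P := shift_symop s2 lD sAA.
have P_form x : D x -> ip (P x) x = ip (A x) (A x) - s2 * ip x x.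
  by move=> Dx; rewrite !ipE (symop_sym sA)//; exact: (symop_stable sA).
have [C C0 hC] : exists2 C : R, 0 < C &
    forall x, D x -> ip (P x) (P x) <= C * ip (P x) x.
  apply: (nonneg_symop_bound sP) => // x Dx.
  by rewrite P_form// subr_ge0 s2_le.
have lowP x : D x -> m * m' * ip x x <= ip (P x) (P x).
  move=> Dx.
  have -> : P x = A (A x - (- s) *: x) - s *: (A x - (- s) *: x).
    rewrite AB AZ !scaleNr !opprK scalerDr scalerA -expr2 ss.
    by rewrite opprD addrA addrK.
  have Dy := symop_stable (shift_symop (- s) lD sA) Dx.
  apply: le_trans (hm _ Dy); rewrite -mulrA ler_pM2l//; exact: hm'.
have : s2 + m * m' / C <= s2.
  apply: lb_le_inf; first by case: infE.
  move=> _ [x [Dx xp] ->]; rewrite ler_pdivlMr// mulrDl.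
  have := le_trans (lowP x Dx) (hC x Dx); rewrite P_form// => h.
  rewrite -lerBrDl mulrAC ler_pdivrMr//; lra.
by rewrite gerDl leNgt divr_gt0// mulr_gt0.
Qed.

(** On the range of [U], Cauchy-Schwarz for the form of [U] turns the
    hypothesis into the conclusion; the range is dense in the orthogonal
    complement of the kernel, and both sides are continuous. *)
Lemma form_bound_coker D U b : closed_manifold D -> symmetric_operator D U ->
  (forall x, D x -> 0 <= ip (U x) x) -> 0 < b ->
  (forall x, D x -> b * ip (U x) x <= ip (U x) (U x)) ->
  forall x, D x -> (forall z, D z -> U z = 0 -> ip x z = 0) ->
  b * ip x x <= ip (U x) x.
Proof.
move=> cD sU U_ge0 b0 hb x Dx xK.
have [U0 UB UZ] := linear_sub0 (symop_linear sU).
have [N N0 hN] := symop_bounded sU.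
have on_range y : D y -> b * ip (U y) (U y) <= ip (U (U y)) (U y).
  move=> Dy; have DUy := symop_stable sU Dy; have DUUy := symop_stable sU DUy.
  have h := hb _ Dy.
  (* nonnegativity of the form of [U] at [y - b^-1 U y] stands in for
     Cauchy-Schwarz between [y] and [U y] *)
  have := U_ge0 _ (manifoldB cD Dy (manifoldZ cD b^-1 DUy)).
  rewrite UB UZ !ipE (symop_sym sU DUy Dy) => h2.
  have bb : b^-1 * b = 1 by rewrite mulVf// gt_eqF.
  have : 0 <= b * (b * (ip (U y) y - b^-1 * ip (U y) (U y) -
     (b^-1 * ip (U y) (U y) - b^-1 * (b^-1 * ip (U (U y)) (U y))))).
    by do 2![apply: mulr_ge0; first exact: ltW]; lra.
  have -> : b * (b * (ip (U y) y - b^-1 * ip (U y) (U y) -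
     (b^-1 * ip (U y) (U y) - b^-1 * (b^-1 * ip (U (U y)) (U y))))) =
     b * (b * ip (U y) y) - 2 * (b^-1 * b) * b * ip (U y) (U y)
       + (b^-1 * b) ^+ 2 * ip (U (U y)) (U y) by ring.
  by rewrite bb; nra.
have lI : linear_manifold (U @` D).
  split; first by exists 0 => //; exact: (manifold0 cD).
  move=> a _ _ [y Dy <-] [z Dz <-]; exists (a *: y + z).
    exact: (manifoldP cD).
  exact: (symop_linear sU).
have xI : adherent (U @` D) x.
  have [w Iw xw] := projection_exists x (adherent_manifold lI).
  have Dw : D w.
    apply: (manifold_closed cD) => e /Iw [_ [y Dy <-] h].
    by exists (U y) => //; exact: (symop_stable sU).
  have Dz := manifoldB cD Dx Dw.
  have Uz0 : U (x - w) = 0.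
    apply: (ip_eq0 ipH).
    rewrite (symop_sym sU)//; last exact: (symop_stable sU).
    apply: xw; apply: subset_adherent; exists (U (x - w)) => //.
    exact: (symop_stable sU).
  suff -> : x = w by [].
  apply/subr0_eq/(ip_eq0 ipH).
  by rewrite ipDl ipNl (xK _ Dz Uz0) sub0r (ipC ipH) (xw _ Iw) oppr0.
rewrite -subr_ge0 leNgt; apply/negP; set f := _ - _ => f0.
pose v := U x - b *: x.
have v0 := ip_ge0 ipH v.
(* [f] is the value at [x] of the form of [U - b], which is nonnegative on the
   range; a point of the range at squared distance less than [d] from [x] is
   so near that the form is still negative there *)
have [t t0 tv] : exists2 t : R, 0 < t & t * ip v v < - f / 2.
  exists (- f / 2 / (ip v v + 1)).
    by rewrite divr_gt0//; lra.
  by rewrite mulrAC ltr_pdivrMr ?ltr_pM2l//; lra.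
have ti : 0 < t^-1 by rewrite invr_gt0.
have [d d0 dt] : exists2 d : R, 0 < d & (t^-1 + (N + 1)) * d = - f / 2.
  have k0 : 0 < t^-1 + (N + 1) by lra.
  exists (- f / 2 / (t^-1 + (N + 1))); first by rewrite divr_gt0//; lra.
  by rewrite mulrC mulfVK// gt_eqF.
have [_ [y Dy <-] hy] := xI _ d0.
have DUy := symop_stable sU Dy.
have := on_range y Dy.
have -> : U y = x - (x - U y) by rewrite subKr.
have Dh := manifoldB cD Dx DUy.
move: (x - U y) hy Dh => h hy Dh.
have vh : ip v h = ip (U x) h - b * ip x h by rewrite /v !ipE.
clearbody v; have := ip_young v (- h) t0.
have := hN h Dh; have := ip_young (U h) h ltr01.
have : (t^-1 + (N + 1)) * ip h h <= (t^-1 + (N + 1)) * d.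
  by rewrite ler_wpM2l// ?ltW//; lra.
have := mulr_ge0 (ltW b0) (ip_ge0 ipH h).
have := mulr_ge0 (ltW N0) (ip_ge0 ipH h).
rewrite dt UB invr1 !ipE vh (symop_sym sU Dh Dx) (ipC ipH h) (ipC ipH h).
move: f0 tv; rewrite /f; have := ip_ge0 ipH h; lra.
Qed.

Lemma scale_symop D A k : linear_manifold D -> k != 0 ->
  symmetric_operator D A -> symmetric_operator D (fun x => k *: A x).
Proof.
move=> lD k0 sA; have [N N0 hN] := symop_bounded sA.
have k2 : 0 < k ^+ 2 by rewrite exprn_even_gt0.
split=> [x Dx|a x y|x y Dx Dy|].
- by apply: manifoldZ => //; exact: (symop_stable sA).
- by rewrite (symop_linear sA) scalerDr !scalerA mulrC.
- by rewrite !ipE (symop_sym sA).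
- exists (k ^+ 2 * N); first exact: mulr_gt0.
  by move=> x Dx; rewrite !ipE mulrA -expr2 -[_ * N * _]mulrA ler_pM2l// hN.
Qed.

(** * Products of two orthogonal projections *)

Definition is_projection (D : set V) (p : V -> V) :=
  forall x, D (p x) /\ forall z, D z -> ip (x - p x) z = 0.

Section Projection.
Variables (D : set V) (p : V -> V).
Hypotheses (lD : linear_manifold D) (pD : is_projection D p).

Lemma projection_in x : D (p x). Proof. by case: (pD x). Qed.

Lemma projection_ip x z : D z -> ip (p x) z = ip x z.
Proof.
case: (pD x) => _ h Dz; have := h z Dz; rewrite ipDl ipNl => /eqP.
by rewrite subr_eq0 => /eqP.
Qed.

Lemma projection_eq x y : D y -> (forall z, D z -> ip y z = ip x z) -> p x = y.
Proof.
move=> Dy h; apply/subr0_eq/(ip_eq0 ipH).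
have Dpy := manifoldB lD (projection_in x) Dy.
by rewrite ipDl ipNl h// projection_ip// subrr.
Qed.

Lemma projection_id x : D x -> p x = x.
Proof. by move=> Dx; exact: projection_eq. Qed.

Lemma projection_linear a x y : p (a *: x + y) = a *: p x + p y.
Proof.
apply: projection_eq; first by apply: manifoldP => //; exact: projection_in.
by move=> z Dz; rewrite !ipE !projection_ip.
Qed.

Lemma projection_le x : ip (p x) (p x) <= ip x x.
Proof.
have := ip_ge0 ipH (x - p x); have := projection_ip x (projection_in x).
rewrite !ipE (ipC ipH (p x) x); lra.
Qed.

End Projection.

Section TwoManifolds.
Variables (F G : set V) (p g : V -> V).
Hypotheses (cF : closed_manifold F) (cG : closed_manifold G).
Hypotheses (pF : is_projection F p) (gG : is_projection G g).

Definition off_meet (D : set V) : set V :=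
  [set x | D x /\ forall z, F z -> G z -> ip x z = 0].

Lemma projection_form x : F x -> ip (p (g x)) x = ip (g x) (g x).
Proof.
move=> Fx; rewrite (projection_ip pF)// [RHS](projection_ip gG); last first.
  exact: (projection_in gG).
exact: (ipC ipH).
Qed.

Lemma projection_symop : symmetric_operator F (p \o g).
Proof.
split=> [x Fx|a x y|x y Fx Fy|] /=.
- exact: (projection_in pF).
- by rewrite (projection_linear cG gG) (projection_linear cF pF).
- rewrite (projection_ip pF)// (ipC ipH x) (projection_ip pF)//.
  rewrite (ipC ipH (g x) y) -(projection_ip gG y (projection_in gG x)).
  rewrite (ipC ipH (g y) (g x)) (projection_ip gG x (projection_in gG y)).
  exact: (ipC ipH).
- exists 1 => // x Fx; rewrite mul1r.
  exact: le_trans (projection_le pF _) (projection_le gG _).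
Qed.

(** The spectra of [P_F P_G] on [F] and of [P_G P_F] on [G] agree away from
    [0]: [P_F] maps approximate eigenvectors of the second operator to those
    of the first, without making them small when [l] is not [0]. *)
Lemma bounded_below_swap l : l != 0 ->
  bounded_below F (fun x => p (g x) - l *: x) ->
  bounded_below G (fun y => g (p y) - l *: y).
Proof.
move=> l0 [m m0 hm].
have [p0 pB pZ] := linear_sub0 (projection_linear cF pF).
have l2 : 0 < l ^+ 2 by rewrite exprn_even_gt0.
have mi : 0 < m^-1 by rewrite invr_gt0.
have k0 : 0 < 2 * m^-1 + 2 by lra.
exists (l ^+ 2 / (2 * m^-1 + 2)); first exact: divr_gt0.
move=> y Gy; set w := g (p y) - l *: y.
have hp : ip (p y) (p y) <= m^-1 * ip w w.
  rewrite ler_pdivlMl//; apply: le_trans (hm _ (projection_in pF y)) _.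
  have -> : p (g (p y)) - l *: p y = p w by rewrite /w pB pZ.
  exact: projection_le.
have hg := projection_le gG (p y).
have yE : l *: y = g (p y) - w by rewrite /w subKr.
have lyy : ip (l *: y) (l *: y) = l ^+ 2 * ip y y by rewrite !ipE mulrA.
rewrite -[_ / _ * _]mulrAC ler_pdivrMr// -lyy yE.
have := ip_ge0 ipH (g (p y) + w); clearbody w.
by rewrite !ipE (ipC ipH w); lra.
Qed.

Section Bound.
Variable c : R.
Hypothesis hc : forall x y, off_meet F x -> off_meet G y ->
  ip x y ^+ 2 <= c ^+ 2 * (ip x x * ip y y).

Lemma projection_off_meet x : off_meet F x -> ip (g x) (g x) <= c ^+ 2 * ip x x.
Proof.
move=> F0x; have [Fx xM] := F0x.
have Ggx := projection_in gG x.
have G0gx : off_meet G (g x).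
  by split=> // z Fz Gz; rewrite (projection_ip gG)//; exact: xM.
have := hc F0x G0gx; rewrite -(projection_ip gG x Ggx).
have := ip_ge0 ipH (g x); rewrite le_eqVlt => /predU1P[<- _|gx0].
  by rewrite mulr_ge0// ?sqr_ge0// (ip_ge0 ipH).
by rewrite expr2 mulrA ler_pM2r.
Qed.

(** On the intersection of [F] and [G], [P_F P_G - l] is multiplication by
    [1 - l]; on the complement of the intersection in [F], the form of
    [l - P_F P_G] is at least [l - c^2] times the squared norm.  Both
    parts are invariant and orthogonal to each other. *)
Lemma bounded_below_off_spectrum l : c ^+ 2 < l -> l != 1 ->
  bounded_below F (fun x => p (g x) - l *: x).
Proof.
move=> cl l1; set k := l - c ^+ 2; have k0 : 0 < k by rewrite subr_gt0.
have k2 : 0 < k ^+ 2 by rewrite exprn_even_gt0//= gt_eqF.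
have l2 : 0 < (1 - l) ^+ 2 by rewrite exprn_even_gt0//= subr_eq0 eq_sym.
have sT := projection_symop.
have [T0 TB TZ] := linear_sub0 (symop_linear sT).
have TD x y : p (g (x + y)) = p (g x) + p (g y).
  by have := symop_linear sT 1 x y; rewrite /= !scale1r.
have cM : closed_manifold (F `&` G).
  split; first split.
  - by split; [exact: (manifold0 cF) | exact: (manifold0 cG)].
  - move=> a x y [Fx Gx] [Fy Gy].
    by split; [exact: (manifoldP cF) | exact: (manifoldP cG)].
  - move=> x Mx.
    split; [apply: (manifold_closed cF) | apply: (manifold_closed cG)];
      by move=> e /Mx [y [Fy Gy] h]; exists y.
exists (Num.min ((1 - l) ^+ 2) (k ^+ 2)); first by rewrite lt_min l2 k2.
move=> x Fx; have [u [Fu Gu] xu] := projection_exists x cM.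
move: (x - u) (subrK u x) xu => v xE vM.
have Fv : F v by have := manifoldB cF Fx Fu; rewrite -xE addrK.
have F0v : off_meet F v by split=> // z Fz Gz; exact: vM.
rewrite -xE.
have Tu : p (g u) = u by rewrite (projection_id cG gG)// (projection_id cF pF).
set w := p (g v) - l *: v.
have -> : p (g (v + u)) - l *: (v + u) = (1 - l) *: u + w.
  rewrite TD Tu scalerDr opprD addrACA scalerBl scale1r.
  by rewrite [LHS]addrC.
have vu : ip v u = 0 by exact: vM.
have wu : ip w u = 0.
  by rewrite /w !ipE (symop_sym sT Fv Fu) /= Tu vu mulr0 subrr.
have ww : k ^+ 2 * ip v v <= ip w w.
  have wv : ip w v = ip (g v) (g v) - l * ip v v.
    by rewrite /w ipDl ipNl ipZl projection_form.
  have := ip_young (- w) v (_ : 0 < k^-1); rewrite invr_gt0 => /(_ k0).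
  rewrite invrK !(ipNl, ipNr) opprK wv mulrC => h.
  have := projection_off_meet F0v; rewrite /k in h * => h2.
  have : (l - c ^+ 2) * ip v v <= (l - c ^+ 2)^-1 * ip w w by lra.
  by rewrite ler_pdivlMl// mulrA -expr2.
clearbody w; rewrite !ipE (ipC ipH u w) (ipC ipH u v) wu vu.
have [m1 m2] : Num.min ((1 - l) ^+ 2) (k ^+ 2) <= (1 - l) ^+ 2 /\
               Num.min ((1 - l) ^+ 2) (k ^+ 2) <= k ^+ 2.
  by rewrite !ge_min !lexx orbT.
have := ler_wpM2r (ip_ge0 ipH u) m1; have := ler_wpM2r (ip_ge0 ipH v) m2.
move: ww; move: (Num.min _ _) => m; lra.
Qed.

End Bound.

(** With no spectrum in [(a, 1)], the operator [U = 1 - P_F P_G] satisfies the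
    hypothesis of [form_bound_coker] for [b = 1 - a], and its kernel in [F] is
    the intersection of [F] and [G]. *)
Lemma spectral_gap_cosine a : a < 1 ->
  (forall l, a < l < 1 -> bounded_below F (fun x => p (g x) - l *: x)) ->
  forall x y, off_meet F x -> off_meet G y ->
  ip x y ^+ 2 <= a * (ip x x * ip y y).
Proof.
move=> a1 gap x y [Fx xM] [Gy _].
suff gx : ip (g x) (g x) <= a * ip x x.
  rewrite -(projection_ip gG x Gy) mulrA.
  apply: le_trans (cauchy_schwarz _ _) _.
  by apply: ler_wpM2r => //; exact: ip_ge0.
have sT := projection_symop.
pose U x := (-1) *: (p (g x) - 1 *: x).
have sU : symmetric_operator F U.
  apply: (scale_symop (k := -1) cF _ (shift_symop 1 cF sT)).
  by rewrite oppr_eq0 oner_eq0.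
have UE z : U z = z - p (g z) by rewrite /U scale1r scaleN1r opprB.
have U_form z : F z -> ip (U z) z = ip z z - ip (g z) (g z).
  by move=> Fz; rewrite UE ipDl ipNl projection_form.
clearbody U; have h : (1 - a) * ip x x <= ip (U x) x.
  apply: (form_bound_coker cF sU) => //.
  - by move=> z Fz; rewrite U_form// subr_ge0; exact: projection_le.
  - by rewrite subr_gt0.
  - move=> z Fz.
    have r0 : 0 <= (1 - a) / 2 by lra.
    have h t : `|t| < (1 - a) / 2 -> bounded_below F
        (fun x => p (g x) - ((1 + a) / 2) *: x - t *: x).
      rewrite ltr_norml => /andP[t1 t2].
      have [|m m0 hm] := gap ((1 + a) / 2 + t); first by apply/andP; split; lra.
      exists m => // w Fw; have := hm w Fw.
      by rewrite scalerDl opprD addrA.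
    (* the midpoint of [(a, 1)] is at distance [(1 - a) / 2] from both ends *)
    have := spectral_gap cF (shift_symop ((1 + a) / 2) cF sT) r0 h Fz.
    have -> : (p \o g) z - ((1 + a) / 2) *: z = ((1 - a) / 2) *: z - U z.
      rewrite UE /= opprB addrCA; congr (_ + _); rewrite -scaleNr.
      rewrite -{3}[z]scale1r -scalerBl; congr (_ *: _); lra.
    rewrite !ipE (ipC ipH z (U z)); lra.
  - move=> z Fz Uz0; apply: xM => //.
    suff -> : z = g z by exact: (projection_in gG).
    have := U_form z Fz; rewrite Uz0 ip0l => zz.
    have zg := projection_ip gG z (projection_in gG z).
    apply/subr0_eq/(ip_eq0 ipH); rewrite !ipE (ipC ipH (g z) z) -zg; lra.
by move: h; rewrite U_form//; lra.
Qed.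

End TwoManifolds.
End RealHilbert.

(** * Infima of sets of angles *)

Lemma ler_cos (R : realType) :
  {in `[0, pi] &, {mono @cos R : x y /~ y <= x}}.
Proof. by move=> x y x0 y0; rewrite !leNgt ltr_cos. Qed.

(** The second hypothesis makes [acos c] a lower bound of [A], the third makes
    it the greatest one; when [A] is empty the third one forces [c = 0], which
    is the cosine of the conventional infimum [pi / 2]. *)
Lemma cos_inf_angle (R : realType) (A : set R) (c : R) : 0 <= c <= 1 ->
  (forall t, A t -> exists2 s : R, 0 <= s <= c & t = acos s) ->
  (forall a : R, 0 <= a < c -> exists2 s : R, a < s <= c & A (acos s)) ->
  c = cos (inf_angle A).
Proof.
move=> /andP[c0 c1] Ac cA.
have itv (s : R) : 0 <= s <= 1 -> s \in `[(-1), 1].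
  by rewrite in_itv/= => /andP[s0 s1]; apply/andP; split; lra.
have acos_itv (s : R) : 0 <= s <= 1 -> acos s \in `[0, pi].
  move=> s01; rewrite in_itv/=; have := itv s s01; rewrite in_itv/= => h.
  by rewrite acos_ge0// acos_lepi.
have acos_le (s s' : R) : 0 <= s <= 1 -> 0 <= s' <= 1 ->
    (acos s <= acos s') = (s' <= s).
  move=> s01 s01'; rewrite -[in RHS](acosK (itv s s01)).
  rewrite -[in RHS](acosK (itv s' s01')).
  by rewrite ler_cos// acos_itv.
have c01 : 0 <= c <= 1 by rewrite c0 c1.
rewrite /inf_angle; case: asboolP => [A0|/eqP/set0P A0].
  rewrite cos_pihalf; apply/eqP; rewrite eq_le c0 andbT leNgt; apply/negP => cp.
  have [|s _] := cA 0; first by rewrite lexx cp.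
  by rewrite A0.
have lbA : lbound A (acos c).
  move=> t /Ac[s /andP[s0 sc] ->]; rewrite acos_le// s0/=.
  exact: le_trans sc c1.
have infA : has_inf A by split=> //; exists (acos c).
have c_le : acos c <= inf A by exact: lb_le_inf.
have [t At] := A0; have [s /andP[s0 sc] ts] := Ac _ At.
have s01 : 0 <= s <= 1 by rewrite s0 (le_trans sc c1).
have inf_le : inf A <= acos s by rewrite -ts; apply: ge_inf => //; case: infA.
have inf_itv : inf A \in `[0, pi].
  move: (acos_itv s s01) (acos_itv c c01); rewrite !in_itv/=.
  move=> /andP[_ h1] /andP[h2 _]; apply/andP; split; lra.
apply/eqP; rewrite eq_le; apply/andP; split; last first.
  by rewrite -[leRHS](acosK (itv c c01)) ler_cos// acos_itv.
rewrite leNgt; apply/negP => h.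
pose a := Num.max 0 (cos (inf A)).
have a_c : 0 <= a < c.
  rewrite le_max lexx/= gt_max h andbT lt_neqAle c0 andbT; apply/eqP => c00.
  move: h inf_le; rewrite -c00 => h.
  have -> : s = 0 by apply/eqP; rewrite eq_le s0 c00 sc.
  move=> inf_le; have : cos (acos 0) <= cos (inf A) :> R.
    by rewrite ler_cos// acos_itv// lexx ler01.
  by rewrite acosK ?itv ?lexx ?ler01// leNgt h.
have [s' /andP[as' sc'] As'] := cA a a_c.
have s01' : 0 <= s' <= 1.
  by case/andP: a_c => a0 _; apply/andP; split; lra.
have : inf A <= acos s' by apply: ge_inf => //; case: infA.
rewrite -ler_cos ?acos_itv// (acosK (itv _ s01')) leNgt => /negP; apply.
by apply: le_lt_trans as'; rewrite le_max lexx orbT.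
Qed.

(** * Real and complex scalars *)

Section Scalars.
Variables (R : realType) (k : scalar_kind).
Local Notation K := (scalars R k).
Local Notation "a %:K" := (of_real k a : K) (at level 2, format "a %:K").

Definition re : K -> R :=
  match k return scalars R k -> R with
  | RealScalars => idfun
  | ComplexScalars => @complex.Re R
  end.

Lemma reD x y : re (x + y) = re x + re y.
Proof. by rewrite /re; case: k x y => //= -[? ?] [? ?]. Qed.

Lemma of_realK a : re a%:K = a.
Proof. by rewrite /re; case: k. Qed.

Lemma re_real a x : re (a%:K * x) = a * re x.
Proof. by rewrite /re; case: k x => //= -[b c] /=; rewrite mul0r subr0. Qed.

Lemma re_conj x : re (conj_scalar x) = re x.
Proof. by rewrite /re; case: k x => //= -[b c]. Qed.

Lemma of_realM a b : (a * b)%:K = a%:K * b%:K.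
Proof. by case: k => //=; exact: rmorphM. Qed.

Lemma of_realD a b : (a + b)%:K = a%:K + b%:K.
Proof. by case: k => //=; exact: rmorphD. Qed.

Lemma of_real1 : 1%:K = 1.
Proof. by case: k. Qed.

Lemma of_real0 : 0%:K = 0.
Proof. by case: k. Qed.

Lemma of_real_le a b : (a%:K <= b%:K) = (a <= b).
Proof. by case: k => //=; exact: lecR. Qed.

Lemma of_real_lt a b : (a%:K < b%:K) = (a < b).
Proof. by case: k => //=; exact: ltcR. Qed.

Lemma ge0_of_real x : 0 <= x -> x = (re x)%:K.
Proof.
rewrite /re; case: k x => //= -[b c]; rewrite lecE /= => /andP[/eqP-> _].
by [].
Qed.

Lemma mul_conj (x : K) : x * conj_scalar x = `|x| ^+ 2.
Proof.
case: k x => /= x; first by rewrite real_normK ?num_real// expr2.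
by rewrite sqr_normc.
Qed.

Lemma re_le_norm (x : K) : re x ^+ 2 <= re `|x| ^+ 2.
Proof.
rewrite /re; case: k x => [x|[b c]]; first by rewrite /= real_normK ?num_real.
rewrite normc_def /= sqr_sqrtr ?lerDl ?sqr_ge0//.
by rewrite addr_ge0 ?sqr_ge0.
Qed.

Lemma norm_re (x : K) : `|x| = (re `|x|)%:K.
Proof. exact: ge0_of_real. Qed.

Lemma re_norm_ge0 (x : K) : 0 <= re `|x|.
Proof. by rewrite -of_real_le -norm_re of_real0. Qed.

End Scalars.

Arguments of_real {R} k.

(** A copy of [H], so that restriction of scalars to [R] can be declared
    without overlapping the module structure of [H] itself. *)
Definition realified (R : realType) (k : scalar_kind)
  (H : lmodType (scalars R k)) : Type := H.

HB.instance Definition _ R k (H : lmodType (scalars R k)) :=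
  GRing.Zmodule.on (@realified R k H).

Section Realified.
Variables (R : realType) (k : scalar_kind) (H : lmodType (scalars R k)).
Let scale (a : R) (x : realified H) : realified H := (of_real k a *: (x : H)).

Let scaleA a b x : scale a (scale b x) = scale (a * b) x.
Proof. by rewrite /scale scalerA of_realM. Qed.
Let scale1 : left_id 1 scale.
Proof. by move=> x; rewrite /scale of_real1 scale1r. Qed.
Let scaleDr : right_distributive scale +%R.
Proof. by move=> a x y; rewrite /scale scalerDr. Qed.
Let scaleDl x : {morph scale^~ x : a b / a + b}.
Proof. by move=> a b; rewrite /scale of_realD scalerDl. Qed.

HB.instance Definition _ := GRing.Zmodule_isLmodule.Build R (realified H)
  scaleA scale1 scaleDr scaleDl.

Lemma realified_scaleE (a : R) (x : realified H) :
  a *: x = of_real k a *: (x : H).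
Proof. by []. Qed.

End Realified.

(** * The Hilbert space as a real inner product space *)

Section Hilbert.
Variables (R : realType) (k : scalar_kind).
Local Notation K := (scalars R k).
Variable H : completeNormedModType K.
Variable dot : {dot H for @conj_scalar R k}.
Hypothesis dot_norm : forall x : H, dot x x = `|x| ^+ 2.
Local Notation "a %:K" := (of_real k a : K) (at level 2, format "a %:K").

Definition re_dot (x y : realified H) : R := re (dot x y).

Lemma dot_linear (a : K) (x y z : H) :
  dot (a *: x + y) z = a * dot x z + dot y z.
Proof. by rewrite linearDl linearZl_LR. Qed.

Lemma dotZr (a : K) (x y : H) : dot x (a *: y) = conj_scalar a * dot x y.
Proof. by rewrite linearZr_LR. Qed.

Lemma dotC (x y : H) : dot x y = conj_scalar (dot y x).
Proof. by rewrite hermitian_subproof expr0 mul1r. Qed.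

Lemma sqr_norm (x : H) : `|x| ^+ 2 = (re_dot x x)%:K.
Proof. by rewrite /re_dot dot_norm -ge0_of_real// exprn_ge0. Qed.

Lemma norm_ltP (x : H) (e : R) : 0 <= e ->
  (`|x| < e%:K) = (re_dot x x < e ^+ 2).
Proof.
move=> e0; rewrite -(of_real_lt k) -sqr_norm of_realM.
by rewrite -expr2 ltr_pXn2r// nnegrE// -(of_real0 R k) of_real_le.
Qed.

Lemma norm_leP (x : H) (e : R) : 0 <= e ->
  (`|x| <= e%:K) = (re_dot x x <= e ^+ 2).
Proof.
move=> e0; rewrite -(of_real_le k) -sqr_norm of_realM.
by rewrite -expr2 ler_pXn2r// nnegrE// -(of_real0 R k) of_real_le.
Qed.

Lemma re_dot_inner_product : inner_product re_dot.
Proof.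
split=> [x y|a x y z|x|x].
- by rewrite /re_dot dotC re_conj.
- by rewrite /re_dot realified_scaleE dot_linear reD re_real.
- by rewrite -(of_real_le k) -sqr_norm of_real0 exprn_ge0.
- move=> x0; apply/eqP; rewrite -(@normr_eq0 _ H) -sqrf_eq0 sqr_norm x0.
  by rewrite of_real0.
Qed.

Lemma pos_of_real (e : K) : 0 < e -> exists2 r : R, 0 < r & e = r%:K.
Proof.
move=> e0; exists (re e); last by apply: ge0_of_real; exact: ltW.
by rewrite -(of_real_lt k) -ge0_of_real ?of_real0// ltW.
Qed.

Lemma re_dot_complete : ip_complete re_dot.
Proof.
move=> u hu.
have : cvg ((u : nat -> H) @ \oo).
  apply/cauchy_cvgP/cauchy_ballP => e /pos_of_real[r r0 ->].
  have [N hN] := hu (r ^+ 2) (exprn_gt0 _ r0).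
  near_simpl; near=> m n => /=.
  rewrite -ball_normE /= norm_ltP ?ltW//; apply: hN.
    by near: m; exact: nbhs_infty_ge.
  by near: n; exact: nbhs_infty_ge.
move=> /cvg_ex[l ul]; exists l => e e0.
have s0 : 0 < (Num.sqrt e)%:K by rewrite -(of_real0 R k) of_real_lt sqrtr_gt0.
move/cvgrPdist_lt/(_ _ s0): ul => [N _ hN].
exists N => n /hN /=; rewrite distrC norm_ltP ?sqrtr_ge0// sqr_sqrtr//.
exact: ltW.
Unshelve. all: by end_near. Qed.

Lemma subspace_closed_manifold (F : set H) : is_subspace F ->
  closed_manifold re_dot (F : set (realified H)).
Proof.
move=> [cF F0 FP]; split; first by split=> // a x y; exact: FP.
move=> x hx; apply: cF => B /nbhs_ballP[_ /pos_of_real[r r0 ->] rB].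
have [y Fy xy] := hx _ (exprn_gt0 2 r0).
by exists y; split=> //; apply: rB; rewrite -ball_normE /= norm_ltP// ltW.
Qed.

Lemma subspaceZ (F : set H) (a : K) x : is_subspace F -> F x -> F (a *: x).
Proof. by move=> [_ F0 FP] Fx; rewrite -[_ *: _]addr0; apply: FP. Qed.

(** As [F] is stable under all scalars, it contains [dot x z *: z], whose inner
    product with [x] is [`|dot x z| ^+ 2], already real. *)
Lemma orthocomplement_re (F : set H) (x : H) : is_subspace F ->
  orthocomplement dot F x <-> forall z, F z -> re_dot x z = 0.
Proof.
move=> sF; split=> h z Fz.
  by rewrite /re_dot h// -(of_real0 R k) of_realK.
have := h _ (subspaceZ (dot x z) sF Fz).
rewrite /re_dot dotZr mulrC mul_conj => n0.
apply/eqP; rewrite -normr_eq0 -sqrf_eq0.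
by rewrite (@ge0_of_real R k (_ ^+ 2)) ?exprn_ge0// n0 of_real0.
Qed.

Lemma subspaceI (F G : set H) :
  is_subspace F -> is_subspace G -> is_subspace (F `&` G).
Proof.
move=> [cF F0 FP] [cG G0 GP]; split; [exact: closedI|by []|].
by move=> a x y [Fx Gx] [Fy Gy]; split; [exact: FP | exact: GP].
Qed.

Section Projector.
Variable F : set H.
Hypothesis sF : is_subspace F.

Lemma projectorP x :
  F (projector dot F x) /\ orthocomplement dot F (x - projector dot F x).
Proof.
apply: (@xgetPex _ 0 [set y | F y /\ orthocomplement dot F (x - y)]).
have cF := subspace_closed_manifold sF.
have [y Fy yx] := projection_exists re_dot_inner_product re_dot_complete x cF.
by exists y; split=> //; apply/orthocomplement_re.
Qed.

Lemma projector_projection : is_projection re_dot F (projector dot F).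
Proof.
by move=> x; have [Fx ox] := projectorP x; split=> //; apply/orthocomplement_re.
Qed.

Lemma projector_linear (a : K) x y :
  projector dot F (a *: x + y) = a *: projector dot F x + projector dot F y.
Proof.
have [_ _ FP] := sF.
have cF := subspace_closed_manifold sF.
have [[Fx ox] [Fy oy]] := (projectorP x, projectorP y).
apply: (projection_eq re_dot_inner_product cF projector_projection).
  exact: FP.
move=> z Fz; have := ox z Fz; have := oy z Fz.
rewrite /re_dot !dot_linear !linearBl /= => /eqP; rewrite subr_eq0 => /eqP ->.
by move=> /eqP; rewrite subr_eq0 => /eqP ->.
Qed.

End Projector.

(** At a real point the resolvent exists as soon as [T - l] is bounded below,
    which is a statement about the real space only.  The inverse inherits
    linearity over [K] from [T], by injectivity. *)
Lemma spectrum_onP (F : set H) (T : H -> H) (l : R) : is_subspace F ->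
  symmetric_operator re_dot F T ->
  (forall (a : K) x y, T (a *: x + y) = a *: T x + T y) ->
  spectrum_on F T l%:K <->
  ~ bounded_below re_dot F (fun x => T x - l *: (x : realified H)).
Proof.
move=> sF sT linT; have [_ F0 FP] := sF.
have ipH := re_dot_inner_product.
have cF := subspace_closed_manifold sF.
pose A x := T x - l%:K *: x.
have linA (a : K) x y : A (a *: x + y) = a *: A x + A y.
  rewrite /A linT scalerBr scalerDr opprD addrACA; congr (_ + (_ - _)).
  by rewrite !scalerA mulrC.
have sA : symmetric_operator re_dot F A := shift_symop ipH l cF sT.
change (spectrum_on F T l%:K <-> ~ bounded_below re_dot F A).
split; [apply: contra_not => bA
  | apply: contra_not => -[S [[SF linS [M SM]] SA]]].
- have inj x y : F x -> F y -> A x = A y -> x = y.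
    move=> Fx Fy xy; case: bA => m m0 hm.
    apply/subr0_eq/(ip_eq0 ipH)/eqP; rewrite eq_le (ip_ge0 ipH) andbT.
    have Axy : A (x - y) = 0 by rewrite addrC -scaleN1r linA xy scaleN1r addNr.
    rewrite -(pmulr_rle0 _ m0); apply: le_trans (hm _ (manifoldB cF Fx Fy)) _.
    by move: Axy => /= ->; rewrite (ip0l ipH).
  pose S y := xget 0 [set x : H | F x /\ A x = y].
  have SP y : F y -> F (S y) /\ A (S y) = y.
    move=> Fy; apply: (@xgetPex _ 0 [set x : H | F x /\ A x = y]).
    have [x Fx xy] := symop_surj ipH re_dot_complete cF sA bA Fy.
    by exists x.
  exists S; split; last first.
    move=> x Fx; split; last by case: (SP x Fx).
    have FAx : F (A x) := symop_stable sA Fx.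
    by have [FSx ASx] := SP _ FAx; exact: inj.
  split=> [x /SP[]//|a x y Fx Fy|].
    have [FSx ASx] := SP _ Fx; have [FSy ASy] := SP _ Fy.
    have [FS AS] := SP _ (FP a x y Fx Fy).
    by apply: inj => //; [exact: FP | rewrite linA ASx ASy].
  case: bA => m m0 hm; exists (Num.sqrt m^-1)%:K => x Fx.
  have [FSx ASx] := SP _ Fx.
  rewrite -(@ler_pXn2r _ 2) ?nnegrE//; last first.
    by rewrite mulr_ge0// -(of_real0 R k) of_real_le sqrtr_ge0.
  rewrite exprMn !sqr_norm expr2 -!of_realM of_real_le -expr2.
  rewrite sqr_sqrtr ?invr_ge0 ?(ltW m0)// ler_pdivlMl//.
  by rewrite -[in leRHS]ASx; exact: hm.
- pose r := re `|M|.
  have r1 : 0 < r ^+ 2 + 1 by have := sqr_ge0 r; lra.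
  exists (r ^+ 2 + 1)^-1; first by rewrite invr_gt0.
  move=> x Fx; rewrite ler_pdivrMl//.
  have FAx : F (A x) := symop_stable sA Fx.
  have [SAx _] := SA x Fx.
  have : `|x| <= r%:K * `|A x|.
    rewrite -norm_re -[in leLHS]SAx -[leLHS]normr_id.
    have := SM _ FAx; rewrite -/(A x) => h.
    apply: le_trans (_ : `|M * `|A x| | <= _).
      rewrite normr_id (le_trans h)// real_ler_norm// ger0_real//.
      exact: le_trans h.
    by rewrite normrM normr_id.
  rewrite -(@ler_pXn2r _ 2) ?nnegrE//; last first.
    by rewrite mulr_ge0// -norm_re.
  rewrite exprMn !sqr_norm expr2 -!of_realM of_real_le -expr2 => h.
  apply: le_trans h _; have := ip_ge0 ipH (A x); rewrite mulrDl mul1r; lra.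
Qed.

(** * The cosine of Friedrichs *)

Section Friedrichs.
Variables F G : set H.
Hypotheses (sF : is_subspace F) (sG : is_subspace G).
Let ipH := re_dot_inner_product.

Lemma ominus_off_meet (D : set H) x :
  ominus dot D (F `&` G) x <-> off_meet re_dot F G D x.
Proof.
split=> -[Dx h]; split=> //.
  by move=> z Fz Gz; have /(orthocomplement_re _ (subspaceI sF sG)) := h; apply.
by apply/(orthocomplement_re _ (subspaceI sF sG)) => z [Fz Gz]; exact: h.
Qed.

Let cosines : set R := [set r : R | exists f g,
    [/\ ominus dot F (F `&` G) f, `|f| <= 1, ominus dot G (F `&` G) g, `|g| <= 1
      & of_real k r = `|dot f g| ] ].

Let cosines0 : cosines 0.
Proof.
have [_ F0 _] := sF; have [_ G0 _] := sG.
have o0 : orthocomplement dot (F `&` G) 0 by move=> y _; rewrite linear0l.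
by exists 0, 0; split; rewrite ?normr0 ?ler01// linear0l normr0 of_real0.
Qed.

(** The modulus of [dot f g] is seen by the real inner product after rotating
    [g]: the product of [f] with [dot f g *: g] is [`|dot f g| ^+ 2]. *)
Let cosines_le a r : 0 <= a ->
  (forall x y, off_meet re_dot F G F x -> off_meet re_dot F G G y ->
    re_dot x y ^+ 2 <= a * (re_dot x x * re_dot y y)) ->
  cosines r -> 0 <= r /\ r ^+ 2 <= a.
Proof.
move=> a0 h [f [g [/ominus_off_meet F0f f1 G0g g1 rE]]].
have r0 : 0 <= r by rewrite -(of_real_le k) rE of_real0.
split=> //; have [->|r_neq0] := eqVneq r 0; first by rewrite expr0n.
have r2 : 0 < r ^+ 2 by rewrite exprn_even_gt0.
have {}G0g : off_meet re_dot F G G (dot f g *: g).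
  apply/ominus_off_meet; case: G0g => Gg og; split; first exact: subspaceZ.
  by move=> y My; rewrite linearZl_LR /= og// mulr0.
have := h f _ F0f G0g.
have -> : re_dot f (dot f g *: g) = r ^+ 2.
  rewrite /re_dot dotZr mulrC mul_conj -rE.
  by rewrite expr2 -of_realM of_realK -expr2.
have -> : re_dot (dot f g *: g) (dot f g *: g) = r ^+ 2 * re_dot g g.
  rewrite -[LHS](of_realK k) -sqr_norm normrZ exprMn -rE sqr_norm expr2.
  by rewrite -!of_realM of_realK -expr2.
have qf : re_dot f f <= 1.
  by rewrite -(expr1n _ 2) -norm_leP// of_real1.
have qg : re_dot g g <= 1.
  by rewrite -(expr1n _ 2) -norm_leP// of_real1.
move=> le; rewrite -(ler_pM2r r2) -expr2; apply: le_trans le _.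
have -> : a * (re_dot f f * (r ^+ 2 * re_dot g g)) =
  a * r ^+ 2 * (re_dot f f * re_dot g g) by ring.
rewrite ler_piMr ?mulr_ge0 ?sqr_ge0//.
by rewrite mulr_ile1// (ip_ge0 ipH).
Qed.

Let has_sup_cosines : has_sup cosines.
Proof.
split; first by exists 0.
exists 1 => r /(cosines_le (a := 1) ler01) h.
have [|r0 r1] := h; last by rewrite -(expr_le1 (n := 2)).
by move=> x y _ _; rewrite mul1r; exact: cauchy_schwarz.
Qed.

Lemma friedrichs_cos_ge0 : 0 <= friedrichs_cos dot F G.
Proof. by apply: ub_le_sup => //; case: has_sup_cosines. Qed.

Lemma friedrichs_cos_le a : 0 <= a ->
  (forall x y, off_meet re_dot F G F x -> off_meet re_dot F G G y ->
    re_dot x y ^+ 2 <= a * (re_dot x x * re_dot y y)) ->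
  friedrichs_cos dot F G ^+ 2 <= a.
Proof.
move=> a0 h; rewrite -[leRHS](sqr_sqrtr a0).
rewrite ler_pXn2r ?nnegrE ?sqrtr_ge0 ?friedrichs_cos_ge0//.
apply: ge_sup; first by exists 0.
move=> r /(cosines_le a0 h) [r0 ra].
by rewrite -(ler_pXn2r (n := 2)) ?nnegrE ?sqrtr_ge0// sqr_sqrtr.
Qed.

Lemma friedrichs_cos_le1 : friedrichs_cos dot F G <= 1.
Proof.
rewrite -(expr_le1 (n := 2)) ?friedrichs_cos_ge0//.
apply: friedrichs_cos_le => // x y _ _; rewrite mul1r; exact: cauchy_schwarz.
Qed.

Let normalized (D : set H) x : is_subspace D -> off_meet re_dot F G D x ->
  0 < re_dot x x -> let s := Num.sqrt (re_dot x x) in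
  ominus dot D (F `&` G) (s^-1%:K *: x) /\ `|s^-1%:K *: x| <= 1.
Proof.
move=> sD /ominus_off_meet[Dx ox] x0 s; split.
  split; first exact: subspaceZ.
  by move=> y My; rewrite linearZl_LR /= ox// mulr0.
have s0 : 0 < s by rewrite sqrtr_gt0.
rewrite -(of_real1 R k) norm_leP// expr1n.
rewrite (ipZl ipH s^-1 x) (ipZr ipH s^-1 x) mulrA -expr2 exprVn.
by rewrite sqr_sqrtr ?(ltW x0)// mulVf// gt_eqF.
Qed.

Lemma le_friedrichs_cos x y :
  off_meet re_dot F G F x -> off_meet re_dot F G G y ->
  re_dot x y ^+ 2 <= friedrichs_cos dot F G ^+ 2 * (re_dot x x * re_dot y y).
Proof.
move=> F0x G0y.
have := ip_ge0 ipH x; rewrite le_eqVlt => /predU1P[/esym x0|x0].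
  by rewrite x0 (ip_eq0 ipH x0) (ip0l ipH) mul0r mulr0 expr0n.
have := ip_ge0 ipH y; rewrite le_eqVlt => /predU1P[/esym y0|y0].
  by rewrite y0 (ip_eq0 ipH y0) (ip0r ipH) !mulr0 expr0n.
have [Fx' x1] := normalized sF F0x x0; have [Gy' y1] := normalized sG G0y y0.
set s := Num.sqrt _ in Fx' x1; set t := Num.sqrt _ in Gy' y1.
set d := dot (s^-1%:K *: x) (t^-1%:K *: y).
have d_le : re `|d| <= friedrichs_cos dot F G.
  apply: ub_le_sup; first by case: has_sup_cosines.
  by exists (s^-1%:K *: x), (t^-1%:K *: y); split=> //; rewrite -norm_re.
have dE : re d = s^-1 * (t^-1 * re_dot x y).
  by rewrite -(ipZr ipH) -(ipZl ipH).
have [s0 t0] : 0 < s /\ 0 < t by rewrite !sqrtr_gt0.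
have -> : re_dot x y = s * t * re d.
  by rewrite dE mulrCA !mulrA; field; rewrite !gt_eqF.
rewrite !exprMn !sqr_sqrtr ?(ltW x0) ?(ltW y0)// mulrC.
apply: ler_wpM2r; first by rewrite mulr_ge0// ltW.
apply: le_trans (re_le_norm d) _.
by rewrite ler_pXn2r ?nnegrE ?re_norm_ge0// friedrichs_cos_ge0.
Qed.

End Friedrichs.

Lemma spectrum_on_projectors (F G : set H) l :
  is_subspace F -> is_subspace G ->
  spectrum_on F (projector dot F \o projector dot G) l%:K <->
  ~ bounded_below re_dot F
     (fun x => projector dot F (projector dot G x) - l *: (x : realified H)).
Proof.
move=> sF sG; apply: spectrum_onP => //.
  exact: (projection_symop re_dot_inner_product
    (subspace_closed_manifold sF) (subspace_closed_manifold sG)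
    (projector_projection sF) (projector_projection sG)).
by move=> a x y /=; rewrite !projector_linear.
Qed.

End Hilbert.

(** * Friedrichs angle and least nonzero angle *)

Theorem theorem2p14 (R : realType) (k : scalar_kind)
    (H : completeNormedModType (scalars R k))
    (dot : {dot H for @conj_scalar R k})
    (dot_norm : forall x : H, dot x x = `|x| ^+ 2)
    (F G : set H)
    (subF : is_subspace F) (F_nontrivial : F <> [set 0])
    (F_proper : F <> setT)
    (subG : is_subspace G) (G_nontrivial : G <> [set 0])
    (G_proper : G <> setT) :
  friedrichs_cos dot F G = cos (inf_angle (angles dot F G `\ 0)).
Proof.
have ipH := re_dot_inner_product dot_norm.
have complH := re_dot_complete dot_norm.
have [cF cG] := (subspace_closed_manifold dot_norm subF,
                 subspace_closed_manifold dot_norm subG).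
have pF := projector_projection dot_norm subF.
have pG := projector_projection dot_norm subG.
set c := friedrichs_cos dot F G.
have c0 : 0 <= c := friedrichs_cos_ge0 dot_norm subF subG.
have c1 : c <= 1 := friedrichs_cos_le1 dot_norm subF subG.
apply: cos_inf_angle; first by rewrite c0 c1.
- move=> _ [[[s [s0 Fs]] <-] _] /eqP t0.
  move/(spectrum_on_projectors dot_norm _ subF subG) in Fs.
  exists s => //; rewrite s0 leNgt; apply/negP => cs; apply: Fs.
  apply: (bounded_below_off_spectrum ipH complH cF cG pF pG (c := c)).
  + by move=> x y; exact: le_friedrichs_cos.
  + by rewrite ltr_pXn2r.
  + apply: contra_neq t0 => /eqP; rewrite sqrf_eq1 => /orP[/eqP->|/eqP sN].
      by rewrite acos1.
    by move: s0; rewrite sN oppr_ge0 ler10.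
- move=> a /andP[a0 ac].
  have [s /andP[as_ s1] Fs] : exists2 s : R, a < s < 1 &
      ~ bounded_below (re_dot dot) F (fun x =>
          projector dot F (projector dot G x) - (s ^+ 2) *: (x : realified H)).
    apply: contrapT => noS.
    suff : c ^+ 2 <= a ^+ 2 by rewrite ler_pXn2r// leNgt ac.
    apply: friedrichs_cos_le => //; first exact: sqr_ge0.
    apply: (spectral_gap_cosine ipH complH cF cG pF pG).
      by rewrite expr_lt1//; exact: lt_le_trans ac c1.
    move=> l /andP[al l1].
    have l0 : 0 <= l by apply: le_trans (sqr_ge0 a) (ltW al).
    apply: contrapT => nl; apply: noS; exists (Num.sqrt l);
      last by rewrite sqr_sqrtr.
    rewrite -(ltr_pXn2r (n := 2)) ?nnegrE ?sqrtr_ge0// sqr_sqrtr// al/=.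
    by rewrite -(expr_lt1 (n := 2)) ?sqrtr_ge0// sqr_sqrtr.
  have s0 : 0 < s := le_lt_trans a0 as_.
  exists s; first (rewrite as_/= leNgt; apply/negP => cs; apply: Fs).
    apply: (bounded_below_off_spectrum ipH complH cF cG pF pG (c := c)).
    + by move=> x y; exact: le_friedrichs_cos.
    + by rewrite ltr_pXn2r// nnegrE ltW.
    + by rewrite lt_eqF// expr_lt1// ltW.
  split; first split.
  + exists s => //; split; first exact: ltW.
    exact/spectrum_on_projectors.
  + exists s => //; split; first exact: ltW.
    apply/spectrum_on_projectors => // Gs; apply: Fs.
    apply: (bounded_below_swap ipH cG pG pF) Gs.
    by rewrite expf_neq0// gt_eqF.
  + by apply/eqP; rewrite gt_eqF// acos_gt0// s1 andbT; lra.
Qed.
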